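(* Two sequences in $\{\mathtt L_0,\mathtt L_1,\mathtt R_0,\mathtt R_1\}^{-\omega}$ are asymptotically equivalent with respect to the group $\mathcal R=\langle P,S,\tau\rangle$ if and only if they can be denoted (in some order) by $w_1,w_2$ so that one of the following conditions is satisfied (equalities of $\theta$ are in $\mathbb R/\mathbb Z$): (1) $p(w_1)=p(w_2)$ and $\theta(w_1)=\theta(w_2)$; (2) $p(w_1)=(\mathtt R\mathtt L)^{-\omega}$, $p(w_2)=(\mathtt L\mathtt R)^{-\omega}$, $\theta(w_1)=\theta(w_2)+\frac23$; (3) $p(w_1)=(\mathtt R\mathtt L)^{-\omega}\mathtt L$, $p(w_2)=(\mathtt L\mathtt R)^{-\omega}\mathtt R$, $\theta(w_1)=\theta(w_2)+\frac13$; (4) there exists a non-empty word $v\in\{\mathtt L,\mathtt R\}^*$ such that $p(w_1)=(\mathtt R\mathtt L)^{-\omega}\mathtt Lv$, $p(w_2)=(\mathtt L\mathtt R)^{-\omega}\mathtt Rv'$, $\theta(w_1)=\theta(w_2)+\frac{1}{2^{|v|}3}$, where $v'$ is obtained from $v$ by changing its first letter.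
   Context: Over the ordered alphabet $X=(\mathtt L_0,\mathtt L_1,\mathtt R_0,\mathtt R_1)=(x_1,x_2,x_3,x_4)$, the notation $g=\sigma_g(g_1,g_2,g_3,g_4)$ means the automorphism of the tree $X^*$ given by $g(x_iu)=x_{\sigma_g(i)}g_i(u)$; in products the right factor acts first. $\mathcal R$ is the group generated by $P=\pi$, $S=\pi\sigma(P\tau^{-1},P,S^{-1}\tau^{-1},S^{-1})$, $\tau=\sigma(1,\tau,1,\tau)$, where $\sigma=(12)(34)$, $\pi=(13)(24)$. Two left-infinite sequences $\ldots x_2x_1$, $\ldots y_2y_1$ are asymptotically equivalent with respect to $\mathcal R$ if there is a sequence $g_n\in\mathcal R$ taking a finite number of values such that $g_n(x_n\ldots x_1)=y_n\ldots y_1$ for all $n$. For $w=\ldots X^{(3)}_{i_3}X^{(2)}_{i_2}X^{(1)}_{i_1}$ with $X^{(k)}\in\{\mathtt L,\mathtt R\}$ and $i_k\in\{0,1\}$ put $p(w)=\ldots X^{(3)}X^{(2)}X^{(1)}\in\{\mathtt L,\mathtt R\}^{-\omega}$ and $\theta(w)=\sum_{k=1}^\infty i_k2^{-k}\in\mathbb R/\mathbb Z$. For a finite word $u$, $u^{-\omega}=\ldots uuu$. *)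

(* Defs.v *)
From HB Require Import structures.
From mathcomp Require Import all_boot all_order all_algebra all_fingroup.
From mathcomp Require Import boolp classical_sets functions cardinality reals.
From mathcomp Require Import topology normedtype sequences.

Set Implicit Arguments.
Unset Strict Implicit.
Unset Printing Implicit Defensive.

Import Order.TTheory GRing.Theory Num.Theory.
Import numFieldNormedType.Exports.
Local Open Scope ring_scope.

Inductive side := L | R.

Inductive letter := L0 | L1 | R0 | R1.

Definition letter_code (x : letter) : bool * bool :=
  match x with
  | L0 => (false, false) | L1 => (false, true)
  | R0 => (true, false) | R1 => (true, true)
  end.

Definition letter_decode (c : bool * bool) : letter :=
  match c with
  | (false, false) => L0 | (false, true) => L1
  | (true, false) => R0 | (true, true) => R1
  end.

Lemma letter_codeK : cancel letter_code letter_decode.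
Proof. by case. Qed.

HB.instance Definition _ := Finite.copy letter (can_type letter_codeK).

Definition letter_side (x : letter) : side :=
  match x with L0 | L1 => L | R0 | R1 => R end.

Definition letter_digit (x : letter) : nat :=
  match x with L0 | R0 => 0 | L1 | R1 => 1 end.

Notation word := (seq letter).

(* An automorphism of the rooted tree X^* is a bijection preserving the levels
   and the prefix relation. *)
Record tree_aut := TreeAut {
  aut :> word -> word;
  autV : word -> word;
  autK : cancel aut autV;
  autVK : cancel autV aut;
  size_aut : forall u, size (aut u) = size u;
  take_aut : forall n u, take n (aut u) = aut (take n u)
}.

Lemma size_autV (g : tree_aut) u : size (autV g u) = size u.
Proof. by rewrite -(size_aut g) autVK. Qed.

Lemma take_autV (g : tree_aut) n u : take n (autV g u) = autV g (take n u).
Proof. by apply: (can_inj (autK g)); rewrite autVK -take_aut autVK. Qed.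

Definition aut_one : tree_aut :=
  @TreeAut id id (fun _ => erefl) (fun _ => erefl) (fun _ => erefl)
    (fun _ _ => erefl).

Definition aut_inv (g : tree_aut) : tree_aut :=
  TreeAut (autVK g) (autK g) (size_autV g) (take_autV g).

Section Mul.
Variables g h : tree_aut.

Lemma size_aut_mul u : size (g (h u)) = size u.
Proof. by rewrite !size_aut. Qed.

Lemma take_aut_mul n u : take n (g (h u)) = g (h (take n u)).
Proof. by rewrite !take_aut. Qed.

(* The right factor acts first. *)
Definition aut_mul : tree_aut :=
  @TreeAut (g \o h) (autV h \o autV g)
    (can_comp (autK g) (autK h)) (can_comp (autVK h) (autVK g))
    size_aut_mul take_aut_mul.
End Mul.

Section Wreath.
Variables (s : {perm letter}) (g1 g2 g3 g4 : tree_aut).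

Definition wreath_section (x : letter) : tree_aut :=
  match x with L0 => g1 | L1 => g2 | R0 => g3 | R1 => g4 end.

Definition wreath_fun (u : word) : word :=
  if u is x :: v then s x :: wreath_section x v else [::].

Definition wreath_inv (u : word) : word :=
  if u is y :: v then
    let x := (s^-1)%g y in x :: autV (wreath_section x) v
  else [::].

Lemma wreath_funK : cancel wreath_fun wreath_inv.
Proof. by case=> [|x v] //=; rewrite permK autK. Qed.

Lemma wreath_invK : cancel wreath_inv wreath_fun.
Proof. by case=> [|y v] //=; rewrite permKV autVK. Qed.

Lemma size_wreath u : size (wreath_fun u) = size u.
Proof. by case: u => [|x v] //=; rewrite size_aut. Qed.

Lemma take_wreath n u : take n (wreath_fun u) = wreath_fun (take n u).
Proof. by case: u n => [|x v] [|n] //=; rewrite take_aut. Qed.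

(* The automorphism written s(g1, g2, g3, g4). *)
Definition wreath : tree_aut :=
  TreeAut wreath_funK wreath_invK size_wreath take_wreath.
End Wreath.

(* A self-referential wreath recursion is solved by iterating [Phi] from the
   identity: the action on level [n] is that of the [n]-th iterate. *)

Definition eq_level (n : nat) (f g : tree_aut) : Prop :=
  forall u, (size u <= n)%N -> f u = g u.

Definition contracting (Phi : tree_aut -> tree_aut) : Prop :=
  forall n f g, eq_level n f g -> eq_level n.+1 (Phi f) (Phi g).

Lemma eq_level_inv n f g :
  eq_level n f g -> eq_level n (aut_inv f) (aut_inv g).
Proof.
move=> fg u un /=; apply: (can_inj (autK g)).
by rewrite autVK -fg ?autVK ?size_autV.
Qed.

Lemma eq_level_mulr n f g h :
  eq_level n f g -> eq_level n (aut_mul f h) (aut_mul g h).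
Proof. by move=> fg u un /=; rewrite fg ?size_aut. Qed.

Lemma eq_level_wreath n s f1 f2 f3 f4 g1 g2 g3 g4 :
  eq_level n f1 g1 -> eq_level n f2 g2 -> eq_level n f3 g3 ->
  eq_level n f4 g4 ->
  eq_level n.+1 (wreath s f1 f2 f3 f4) (wreath s g1 g2 g3 g4).
Proof.
move=> e1 e2 e3 e4 [|x v] //= vn; congr (_ :: _).
by case: x => /=; [apply: e1|apply: e2|apply: e3|apply: e4].
Qed.

Section Fix.
Variables (Phi : tree_aut -> tree_aut) (PhiC : contracting Phi).

Let it n := iter n Phi aut_one.

Lemma iter_level m n u : (size u <= n)%N -> it (n + m) u = it n u.
Proof.
move: u; change (eq_level n (it (n + m)) (it n)).
elim: n => [|n IHn]; last exact: PhiC.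
move=> u; rewrite leqn0 => /nilP->.
by rewrite (size0nil (size_aut _ [::])) (size0nil (size_aut _ [::])).
Qed.

Definition fix_fun (u : word) : word := it (size u) u.
Definition fix_inv (u : word) : word := autV (it (size u)) u.

Lemma fix_funK : cancel fix_fun fix_inv.
Proof. by move=> u; rewrite /fix_inv /fix_fun size_aut autK. Qed.

Lemma fix_invK : cancel fix_inv fix_fun.
Proof. by move=> u; rewrite /fix_inv /fix_fun size_autV autVK. Qed.

Lemma size_fix u : size (fix_fun u) = size u.
Proof. exact: size_aut. Qed.

Lemma take_fix n u : take n (fix_fun u) = fix_fun (take n u).
Proof.
have le : (size (take n u) <= size u)%N by rewrite size_take_min geq_minr.
by rewrite /fix_fun take_aut -{1}(subnKC le) iter_level.
Qed.

Definition aut_fix : tree_aut :=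
  TreeAut fix_funK fix_invK size_fix take_fix.

Lemma aut_fixE : aut_fix =1 Phi aut_fix.
Proof.
move=> u; have e : eq_level (size u) aut_fix (it (size u)).
  by move=> v vu /=; rewrite /fix_fun -(subnKC vu) iter_level.
rewrite (PhiC e) //.
by change (it (size u) u = it (size u).+1 u); rewrite -addn1 iter_level.
Qed.
End Fix.

Definition perm_sigma : {perm letter} := (tperm L0 L1 * tperm R0 R1)%g.
Definition perm_pi : {perm letter} := (tperm L0 R0 * tperm L1 R1)%g.

Definition gen_P : tree_aut := wreath perm_pi aut_one aut_one aut_one aut_one.

Definition tau_rec (t : tree_aut) : tree_aut :=
  wreath perm_sigma aut_one t aut_one t.

Lemma tau_rec_contracting : contracting tau_rec.
Proof. by move=> n f g fg; apply: eq_level_wreath. Qed.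

Definition gen_tau : tree_aut := aut_fix tau_rec_contracting.

Lemma gen_tauE : gen_tau =1 wreath perm_sigma aut_one gen_tau aut_one gen_tau.
Proof. exact: aut_fixE. Qed.

(* The product of {perm letter} applies its left factor first, so
   [perm_sigma * perm_pi] is pi sigma (and the two permutations commute). *)
Definition S_rec (s : tree_aut) : tree_aut :=
  wreath (perm_sigma * perm_pi)%g
    (aut_mul gen_P (aut_inv gen_tau)) gen_P
    (aut_mul (aut_inv s) (aut_inv gen_tau)) (aut_inv s).

Lemma S_rec_contracting : contracting S_rec.
Proof.
move=> n f g fg; apply: eq_level_wreath => //; last exact: eq_level_inv.
by apply: eq_level_mulr; apply: eq_level_inv.
Qed.

Definition gen_S : tree_aut := aut_fix S_rec_contracting.

Lemma gen_SE :
  gen_S =1 wreath (perm_sigma * perm_pi)%g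
            (aut_mul gen_P (aut_inv gen_tau)) gen_P
            (aut_mul (aut_inv gen_S) (aut_inv gen_tau)) (aut_inv gen_S).
Proof. exact: aut_fixE. Qed.

Inductive in_group : tree_aut -> Prop :=
  | in_P : in_group gen_P
  | in_S : in_group gen_S
  | in_tau : in_group gen_tau
  | in_one : in_group aut_one
  | in_mul g h : in_group g -> in_group h -> in_group (aut_mul g h)
  | in_inv g : in_group g -> in_group (aut_inv g).

(* The left-infinite sequence ... x_3 x_2 x_1 is the function mapping k to
   x_(k+1). Finite words are still read from left to right, so that the last
   letter of a word is the one with the smallest index. *)

Definition lseq (A : Type) := nat -> A.

(* x_n ... x_1 *)
Definition lseq_trunc (A : Type) (w : lseq A) (n : nat) : seq A :=
  rev (mkseq w n).

(* The sequence w followed on the right by the finite word v; the default value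
   of [nth] is never used. *)
Definition lseq_cat (A : Type) (w : lseq A) (v : seq A) : lseq A :=
  fun k => if (k < size v)%N then nth (w 0%N) (rev v) k else w (k - size v)%N.

(* ... u u u; meaningful only if u is non-empty. *)
Definition lseq_pow (u : seq side) : lseq side :=
  fun k => nth L (rev u) (k %% size u).

Definition asymp_equiv (x y : lseq letter) : Prop :=
  exists g : nat -> tree_aut,
    [/\ forall n, in_group (g n),
        finite_set (range g) &
        forall n, g n (lseq_trunc x n) = lseq_trunc y n].

Definition proj (w : lseq letter) : lseq side := fun k => letter_side (w k).

Section Theta.
Variable K : realType.

Definition theta_term (w : lseq letter) : K^nat :=
  fun k => (letter_digit (w k))%:R / 2 ^+ k.+1.

Definition theta (w : lseq letter) : K := limn (series (theta_term w)).

(* Equality in R/Z. *)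
Definition eq_mod1 (a b : K) : Prop := a - b \is a Num.int.

Lemma theta_cvg w : cvgn (series (theta_term w)).
Proof.
have h0 : 0 <= 2^-1 :> K by rewrite invr_ge0.
apply: (@series_le_cvg _ _ (geometric (2^-1) (2^-1 : K))).
- by move=> k; rewrite /theta_term divr_ge0 ?exprn_ge0.
- by move=> k; rewrite /geometric /= mulr_ge0 ?exprn_ge0.
- move=> k; rewrite /theta_term /geometric /= -exprVn exprS.
  by case: (w k) => /=; rewrite ?mul1r ?mul0r // mulr_ge0 ?exprn_ge0.
- by apply: is_cvg_geometric_series; rewrite ger0_norm // invf_lt1 // ltr1n.
Qed.
End Theta.

Definition flip (a : side) : side := if a is L then R else L.

Definition change_first (v : seq side) : seq side :=
  if v is a :: u then flip a :: u else [::].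

Notation RLpow := (lseq_pow [:: R; L]).
Notation LRpow := (lseq_pow [:: L; R]).

Definition cond1 (K : realType) (w1 w2 : lseq letter) : Prop :=
  proj w1 =1 proj w2 /\ eq_mod1 (theta K w1) (theta K w2).

Definition cond2 (K : realType) (w1 w2 : lseq letter) : Prop :=
  [/\ proj w1 =1 RLpow, proj w2 =1 LRpow &
      eq_mod1 (theta K w1) (theta K w2 + 2 / 3)].

Definition cond3 (K : realType) (w1 w2 : lseq letter) : Prop :=
  [/\ proj w1 =1 lseq_cat RLpow [:: L], proj w2 =1 lseq_cat LRpow [:: R] &
      eq_mod1 (theta K w1) (theta K w2 + 1 / 3)].

Definition cond4 (K : realType) (w1 w2 : lseq letter) : Prop :=
  exists v : seq side,
    [/\ v <> [::],
        proj w1 =1 lseq_cat RLpow (L :: v),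
        proj w2 =1 lseq_cat LRpow (R :: change_first v) &
        eq_mod1 (theta K w1) (theta K w2 + 1 / (2 ^+ size v * 3))].

(* Main.v *)
From mathcomp Require Import all_boot all_order all_algebra all_fingroup.
From mathcomp Require Import boolp classical_sets functions cardinality reals.
From mathcomp Require Import topology normedtype sequences.
From mathcomp Require Import zify ring lra.
Require Import Defs.

Set Implicit Arguments.
Unset Strict Implicit.
Unset Printing Implicit Defensive.

Import Order.TTheory GRing.Theory Num.Theory.
Import numFieldNormedType.Exports.
Local Open Scope classical_set_scope.
Local Open Scope ring_scope.

(** Read the digits of a word as a binary integer, its leftmost letter being the
least significant one. In the coordinates (sides, integer modulo 2^n) on the words
of length n, [gen_tau] adds 1 to the integer, [gen_P] flips the leftmost side, and
[gen_S] acts in both coordinates in a way governed by the sides alone: it flips the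
maximal alternating prefix R L R L ... together with the next two sides, and
subtracts from the integer an alternating sum 1 - 2 + 4 - ... with one term for each
side of that prefix and one more for the side that breaks it. That sum is
(1 - (-2)^m) / 3, with m its number of terms ([S_coords], [carryE]).

For a truncation x_n ... x_1, the integer divided by 2^n tends to the angle theta.
In the limit [gen_P] and [gen_tau] therefore move neither the sides nor the angle
modulo 1. If the alternating prefix of the truncations stops ever further from the
right end, the same is true of [gen_S], since m stays far below n. If it stops at a
bounded distance j from the right end, then in the limit the sides alternate from
position j on to the left, [gen_S] flips them together with the next two sides, and
the angle changes by a constant that depends on j ([angle_S]). This yields the last three
conditions at once: j = 0, j = 1 and j = |v| + 1 ([crossed], [linkedE]).

An element that sends arbitrarily long truncations of x to those of y is a product
of generators, and the intermediate words need not be truncations of one sequence.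
They have a limit along an ultrafilter, however, so each generator only has to be
examined on limits ([tame_in_group]); the resulting steps compose because the
relation of the theorem is transitive ([linked_trans]): the alternating left part of
a sequence of sides ends at a unique position, and the side there tells which member
of a pair the sequence is.

Conversely, for related sequences one of 1, P, S, S^-1 gives the right sides, and the
integers then differ by a bounded amount modulo 2^n, which a bounded power of
[gen_tau] corrects ([asymp_of_reached]). *)

(** * Words as pairs of sides and an integer *)

Definition sides (u : word) : seq side := map letter_side u.

Fixpoint value (u : word) : int :=
  if u is x :: v then (letter_digit x)%:Z + 2 * value v else 0.

Lemma size_sides u : size (sides u) = size u.
Proof. exact: size_map. Qed.

Lemma value_cat u v : value (u ++ v) = value u + 2 ^+ size u * value v.
Proof.
elim: u => [|x u IHu] /=; first by rewrite add0r mul1r.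
by rewrite IHu exprS; ring.
Qed.

Lemma value_bounds u : 0 <= value u < 2 ^+ size u.
Proof. by elim: u => [//|x u IHu] /=; rewrite exprS; case: x => /=; lia. Qed.

Lemma word_inj u v : sides u = sides v -> value u = value v -> u = v.
Proof.
elim: u v => [|x u IHu] [|y v] //= [xy uv] e.
have [exy euv] : letter_digit x = letter_digit y /\ value u = value v.
  by case: x y e {xy} => -[] /=; lia.
by rewrite (IHu v) //; congr (_ :: _); case: x y xy exy {e} => -[].
Qed.

Lemma sides_P u : sides (gen_P u) = change_first (sides u).
Proof. by case: u => [//|x u]; rewrite /= !permE; case: x; rewrite /= !permE. Qed.

Lemma value_P u : value (gen_P u) = value u.
Proof. by case: u => [//|x u]; rewrite /= !permE; case: x; rewrite /= !permE. Qed.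

(** Meant for words of equal size [n]: their integers matter only modulo 2^n. *)
Definition moved (u v : word) (c : int) : Prop :=
  exists q : int, value v = value u + c + q * 2 ^+ size u.

Lemma tau_coords u : sides (gen_tau u) = sides u /\ moved u (gen_tau u) 1.
Proof.
elim: u => [|x u [IHs [q IHq]]].
  by rewrite (size0nil (size_aut _ [::])); split => //; exists (-1).
rewrite gen_tauE /= !permE /=; case: x; rewrite /= !permE /= ?IHs; split => //;
  rewrite /moved /= ?IHq exprS; (exists 0; lia) || (exists q; lia).
Qed.

(** * The action of S *)

Lemma tauV_coords u :
  sides (autV gen_tau u) = sides u /\ moved u (autV gen_tau u) (-1).
Proof.
have [s [q m]] := tau_coords (autV gen_tau u).
move: s m; rewrite size_autV autVK => s m; split=> //.
by exists (- q); rewrite m; lia.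
Qed.

Definition same (a b : side) : bool :=
  match a, b with L, L | R, R => true | _, _ => false end.

Lemma sameP a b : reflect (a = b) (same a b).
Proof. by case: a b => -[]; constructor. Qed.

Lemma flipK : involutive flip.
Proof. by case. Qed.

(** The states [R] and [L] of the recursion stand for S and S^-1: on the side that
equals the state the section is the inverse of the current automorphism, on the other
side it is P, in both cases up to a power of tau. *)
Fixpoint run (a : side) (s : seq side) : nat :=
  if s is b :: t then if same b a then (run (flip a) t).+1 else 0%N else 0%N.

Fixpoint cross (a : side) (s : seq side) : seq side :=
  if s is b :: t then
    flip b :: if same b a then cross (flip a) t else change_first t
  else [::].

Fixpoint carry (a : side) (s : seq side) : int :=
  if s is b :: t then 1 + (if same b a then - 2 * carry (flip a) t else 0)
  else 0.

Lemma size_change_first s : size (change_first s) = size s.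
Proof. by case: s. Qed.

Lemma change_firstK : involutive change_first.
Proof. by case=> [|a s] //=; rewrite flipK. Qed.

Lemma crossK a s : cross (flip a) (cross a s) = s.
Proof.
elim: s a => [//|b s IHs] a /=; rewrite flipK; congr (_ :: _).
by case: a b => -[] /=; rewrite ?change_firstK //; apply: IHs.
Qed.

(** With [crossK], this turns the coordinates of S into those of S^-1. *)
Lemma carry_cross a s : carry (flip a) (cross a s) = carry a s.
Proof.
elim: s a => [//|b s IHs] a /=; congr (1 + _).
by case: a b => -[] //=; rewrite (IHs L, IHs R).
Qed.

Lemma run_le a s : (run a s <= size s)%N.
Proof. by elim: s a => [//|b s IHs] a /=; case: (same b a) => //=; apply: IHs. Qed.

Lemma nth_cross a s k : (k < size s)%N ->
  nth L (cross a s) k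
  = if (k <= (run a s).+1)%N then flip (nth L s k) else nth L s k.
Proof.
elim: s a k => [//|b s IHs] a [|k] //= ks.
case: (same b a) => /=; first exact: IHs.
by case: s k ks {IHs} => [|c s] [|k].
Qed.

Lemma nth_run a s k : (k < run a s)%N -> nth L s k = iter k flip a.
Proof.
elim: s a k => [//|b s IHs] a k /=.
case: (sameP b a) => // -> ; case: k => [//|k]; rewrite ltnS iterSr.
exact: IHs.
Qed.

Lemma nth_break a s : (run a s < size s)%N ->
  nth L s (run a s) = iter (run a s).+1 flip a.
Proof.
elim: s a => [//|b s IHs] a /=.
case: (sameP b a) => [_|ba _] /=; last by case: a b ba => -[].
by rewrite ltnS => /IHs ->; rewrite -!iterSr.
Qed.

Lemma run_eq a s k : (k <= size s)%N ->
  (forall i, (i < k)%N -> nth L s i = iter i flip a) ->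
  ((k < size s)%N -> nth L s k = iter k.+1 flip a) -> run a s = k.
Proof.
elim: s a k => [|b s IHs] a [|k] //=.
  by move=> _ _ /(_ isT) ->; case: a.
move=> ks h e; have /= -> := h 0%N isT.
case: (sameP a a) => // _; congr _.+1; apply: IHs => // [i ik|ks'].
  by rewrite -iterSr; apply: (h i.+1).
by rewrite -iterSr; apply: e.
Qed.

(** The carry is the geometric sum of the powers of -2, which runs through the
alternating prefix and through the breaking side when there is one. *)
Lemma carryE a s : 3 * carry a s = 1 - (-2) ^+ minn (run a s).+1 (size s).
Proof.
elim: s a => [|b s IHs] a /=; first by rewrite minn0 expr0.
case: (same b a) => /=; last by rewrite minnSS min0n expr1.
by rewrite mulrDr mulrCA IHs minnSS exprS; ring.
Qed.

Definition S_from (a : side) : tree_aut := if a is R then gen_S else aut_inv gen_S.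

(** The exponent of S in [S_from a]. *)
Definition sgn (a : side) : int := if a is R then 1 else -1.

(** Restricted to one size so that it can be used inside the induction that computes
S, where the recursion calls S^-1. *)
Lemma Sinv_of u :
  (forall w, size w = size u ->
    sides (gen_S w) = cross R (sides w) /\
    moved w (gen_S w) (- carry R (sides w))) ->
  sides (autV gen_S u) = cross L (sides u) /\
  moved u (autV gen_S u) (carry L (sides u)).
Proof.
move=> /(_ (autV gen_S u)); rewrite autVK size_autV => -[//|su [q vu]].
rewrite /moved su (crossK R) (carry_cross R); split => //.
by exists (- q); rewrite vu size_autV; lia.
Qed.

Lemma value_cons x u : value (x :: u) = (letter_digit x)%:Z + 2 * value u.
Proof. by []. Qed.

Lemma gen_S_cons x u : gen_S (x :: u) =
  match x with
  | L0 => R1 :: gen_P (autV gen_tau u)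
  | L1 => R0 :: gen_P u
  | R0 => L1 :: autV gen_S (autV gen_tau u)
  | R1 => L0 :: autV gen_S u
  end.
Proof.
rewrite gen_SE /wreath /=.
by case: x; congr (_ :: _); rewrite !permE /= !permE /= !permE.
Qed.

(** Since S commutes with tau, the inverse powers of tau in its sections contribute
only to the integer, where they bring the even and the odd case to the same
result. *)
Lemma gen_S_coords u :
  sides (gen_S u) = cross R (sides u) /\
  moved u (gen_S u) (- carry R (sides u)).
Proof.
have [n] := ubnP (size u); elim: n u => // n IHn [|x u].
  by rewrite (size0nil (size_aut _ [::])); split => //; exists 0.
move=> xun; have un : (size u < n)%N by []; clear xun.
have Sinv v : size v = size u -> sides (autV gen_S v) = cross L (sides v) /\
  moved v (autV gen_S v) (carry L (sides v)).
  by move=> vu; apply: Sinv_of => w wv; apply: IHn; rewrite wv vu.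
have [st [qt mt]] := tauV_coords u.
rewrite gen_S_cons /moved; case: x.
- rewrite [sides _]/= sides_P st value_cons value_P mt; split => //; exists qt.
  by rewrite /= exprS; ring.
- rewrite [sides _]/= sides_P value_cons value_P; split => //; exists 0.
  by rewrite /= ; ring.
- have [s [q m]] := Sinv _ (@size_autV gen_tau u).
  rewrite [sides _]/= s value_cons st m mt st size_autV; split => //.
  by exists (q + qt); rewrite /= exprS; ring.
- have [s [q m]] := Sinv u erefl.
  rewrite [sides _]/= s value_cons m; split => //; exists q.
  by rewrite /= exprS; ring.
Qed.

Lemma S_coords a u :
  sides (S_from a u) = cross a (sides u) /\
  moved u (S_from a u) (- sgn a * carry a (sides u)).
Proof.
case: a; last by rewrite mulN1r; apply: gen_S_coords.
by rewrite opprK mul1r; apply: Sinv_of => w _; apply: gen_S_coords.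
Qed.

(** * From integers to angles *)

Lemma truncS (A : Type) (w : lseq A) n :
  lseq_trunc w n.+1 = w n :: lseq_trunc w n.
Proof. by rewrite /lseq_trunc mkseqS rev_rcons. Qed.

Lemma size_trunc (A : Type) (w : lseq A) n : size (lseq_trunc w n) = n.
Proof. by rewrite size_rev size_mkseq. Qed.

Definition agrees (N : nat) (u : word) (x : lseq letter) : Prop :=
  (N <= size u)%N /\ drop (size u - N) u = lseq_trunc x N.

Lemma agrees_trunc x N n : (N <= n)%N -> agrees N (lseq_trunc x n) x.
Proof.
rewrite /agrees size_trunc => Nn; split => //.
rewrite -{2}(subnK Nn); elim: (n - N)%N => [|m IHm]; first by rewrite drop0.
by rewrite addSn truncS.
Qed.

Lemma agrees_side N u x i : agrees N u x -> (i < N)%N ->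
  nth L (sides u) (size u - i.+1) = proj x i.
Proof.
move=> [Nu e] iN.
have -> : (size u - i.+1 = (size u - N) + (N - i.+1))%N by lia.
rewrite -nth_drop -map_drop e (nth_map L0) ?size_trunc; last by lia.
rewrite nth_rev size_mkseq ?nth_mkseq; try lia.
by congr (letter_side (x _)); lia.
Qed.

Section Angle.
Variable K : realType.

Definition angle (u : word) : K := (value u)%:~R / 2 ^+ size u.

Lemma exp2_gt0 n : 0 < 2 ^+ n :> K.
Proof. by rewrite exprn_gt0. Qed.

Lemma series_theta x n : series (theta_term K x) n = angle (lseq_trunc x n).
Proof.
elim: n => [|n IHn]; first by rewrite /series /= big_geq // /angle mul0r.
rewrite seriesSr IHn /angle truncS /= size_trunc /theta_term.
have ne0 : 2 ^+ n != 0 :> K by rewrite gt_eqF ?exp2_gt0.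
by rewrite exprS intrD intrM mulrz_nat; field.
Qed.

(** Letters on the left are less significant, hence perturb the angle by less than
one unit of the last digit of [v]. *)
Lemma angle_cat u v : angle v <= angle (u ++ v) <= angle v + 1 / 2 ^+ size v.
Proof.
have /andP[u0 u1] := value_bounds u.
have {}u0 : 0 <= (value u)%:~R :> K by rewrite ler0z.
have {}u1 : (value u)%:~R <= 2 ^+ size u :> K.
  by rewrite -(ltr_int K) rmorphXn /= in u1; apply: ltW.
have pu := exp2_gt0 (size u); have pv := exp2_gt0 (size v).
have -> : angle (u ++ v) = angle v + (value u)%:~R / 2 ^+ size u / 2 ^+ size v.
  rewrite /angle value_cat size_cat exprD intrD intrM rmorphXn /=.
  by field; rewrite !gt_eqF.
apply/andP; split; first by rewrite lerDl !divr_ge0 // ltW.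
by rewrite lerD2l ler_wpM2r ?invr_ge0 ?(ltW pv) // ler_pdivrMr // mul1r.
Qed.

Lemma agrees_angle N u x : agrees N u x ->
  angle (lseq_trunc x N) <= angle u <= angle (lseq_trunc x N) + 1 / 2 ^+ N.
Proof.
move=> [_ e]; have := angle_cat (take (size u - N) u) (lseq_trunc x N).
by rewrite size_trunc -e cat_take_drop.
Qed.

Lemma theta_bounds N x :
  angle (lseq_trunc x N) <= theta K x <= angle (lseq_trunc x N) + 1 / 2 ^+ N.
Proof.
have cv := @theta_cvg K x.
have b n : (N <= n)%N -> angle (lseq_trunc x N) <= series (theta_term K x) n
    <= angle (lseq_trunc x N) + 1 / 2 ^+ N.
  by move=> Nn; rewrite series_theta; apply/agrees_angle/agrees_trunc.
apply/andP; split.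
  by apply: limr_ge => //; exists N => // n /= /b /andP[].
by apply: limr_le => //; exists N => // n /= /b /andP[].
Qed.

Lemma agrees_theta N u x : agrees N u x -> `|theta K x - angle u| <= 1 / 2 ^+ N.
Proof.
move=> /agrees_angle /andP[a1 a2]; have /andP[t1 t2] := theta_bounds N x.
by rewrite ler_norml; apply/andP; split; lra.
Qed.

Lemma small_exp2 (C e : K) : 0 < e -> exists N, C / 2 ^+ N < e.
Proof.
move=> e0; have [N CN] : exists N : nat, C / e < N%:R.
  exists (Num.truncn `|C / e|).+1.
  by apply: le_lt_trans (ler_norm _) _; apply: truncnS_gt.
exists N; rewrite ltr_pdivrMr ?exp2_gt0 // mulrC -ltr_pdivrMr //.
by apply: lt_trans CN _; rewrite -natrX ltr_nat ltn_expl.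
Qed.

Lemma near_int (C a : K) :
  (forall N, exists q : int, `|a - q%:~R| <= C / 2 ^+ N) -> a \is a Num.int.
Proof.
move=> near; set f := a - (Num.floor a)%:~R.
have /andP[f0 f1] : 0 <= f < 1.
  have /andP[h1 h2] := floor_itv a.
  by rewrite intrD in h2; apply/andP; split; rewrite /f; lra.
have [f_eq0|fN0] := eqVneq f 0.
  by apply/intrP; exists (Num.floor a); apply/eqP; rewrite -subr_eq0 -f_eq0.
have [N small] : exists N, C / 2 ^+ N < Num.min f (1 - f).
  by apply: small_exp2; rewrite lt_min lt_def fN0 f0 /=; lra.
have [q aq] := near N; have := le_lt_trans aq small.
rewrite lt_min !ltr_norml => /andP[/andP[h1 h2] /andP[h3 h4]]; exfalso.
have [qf|qf] := leP q (Num.floor a).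
  by move: qf; rewrite -(ler_int K) => qf; rewrite /f in h2; lra.
by move: qf; rewrite -lezD1 -(ler_int K) intrD => qf; rewrite /f in h3; lra.
Qed.

(** The change of angle when the alternating part ends at position [j]. Modulo 1 it is
- 2^(1 - j) / 3 for every [j]; at [j = 0] the representative 1/3 is the one that the
geometric sum produces, as the word ends before a breaking side. *)
Definition kappa (j : nat) : K := if j is i.+1 then - (1 / (2 ^+ i * 3)) else 1 / 3.

Lemma sgn_norm a : `|(sgn a)%:~R : K| = 1.
Proof. by case: a; rewrite /= ?normrN1 ?normr1. Qed.

Lemma sgn_iter a b : sgn (iter b flip a) = (-1) ^+ b * sgn a.
Proof.
elim: b => [|b IHb]; first by rewrite mul1r.
by rewrite iterS exprS -mulrA -IHb; case: (iter b flip a).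
Qed.

(** The term with 2^n in the denominator comes from the 1 in the geometric sum and
vanishes in the limit; the power of -2 becomes [kappa], whose sign depends only on
the side that would continue the alternating prefix. *)
Lemma angle_S a u : let b := run a (sides u) in
  exists q : int, angle (S_from a u) = angle u
    - (sgn a)%:~R / (3 * 2 ^+ size u)
    + (sgn (iter b flip a))%:~R * kappa (size u - b) + q%:~R.
Proof.
move=> b; have [_ [q vq]] := S_coords a u; exists q.
have b_le : (b <= size u)%N by rewrite -size_sides run_le.
have := carryE a (sides u); rewrite -/b size_sides.
move=> /(congr1 (fun z : int => z%:~R : K)).
rewrite intrM intrB rmorphXn /= => cE.
rewrite /angle size_aut vq intrD intrM rmorphXn /= intrD intrM intrN.
set c : K := (carry _ _)%:~R in cE *.
rewrite sgn_iter intrM rmorphXn /=.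
have ne0 n : 2 ^+ n != 0 :> K by rewrite gt_eqF ?exp2_gt0.
have {cE} -> : c = (1 - (-2)%:~R ^+ minn b.+1 (size u)) / 3.
  by rewrite -cE; field.
(* The sign (-1)^b is absorbed by [sgn]; the sum has [b] terms if no side breaks the
   prefix and [b + 1] otherwise. *)
have -> : (-2)%:~R = -1 * 2 :> K by rewrite mulN1r.
rewrite exprMn; move: b_le; rewrite leq_eqVlt => /orP[/eqP ->|b_lt].
  by rewrite subnn (minn_idPr (leqnSn _)) /=; field.
have [d ->] : exists d, size u = (b + d.+1)%N by exists (size u - b.+1)%N; lia.
have -> : minn b.+1 (b + d.+1) = b.+1 by lia.
have -> : (b + d.+1 - b = d.+1)%N by lia.
by rewrite /= exprD !exprS; field; rewrite !ne0.
Qed.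
End Angle.

(** * The relation of the theorem is an equivalence *)

Lemma flip_neq a : flip a <> a.
Proof. by case: a. Qed.

(** For [j = 0] the sequence alternates throughout. *)
Definition breaks_at (s : lseq side) (j : nat) : Prop :=
  (forall i, (j <= i)%N -> s i.+1 = flip (s i)) /\
  ((0 < j)%N -> s j.-1 = s j).

Lemma breaks_at_inj s j j' : breaks_at s j -> breaks_at s j' -> j = j'.
Proof.
wlog jj' : j j' / (j < j')%N => [wl b b'|[alt _] [_ brk]].
  by case: (ltngtP j j') => // h; [exact: wl|apply/esym/wl].
case: j' jj' brk => [//|j']; rewrite ltnS => /alt -> /(_ isT) /= e.
by case: (flip_neq (esym e)).
Qed.

Lemma breaks_iter s j k i : breaks_at s j -> (j + i <= k)%N ->
  s (k - i)%N = iter i flip (s k).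
Proof.
move=> [alt _]; elim: i => [|i IHi] jk; first by rewrite subn0.
rewrite iterS -IHi; last by lia.
have -> : (k - i = (k - i.+1).+1)%N by lia.
by rewrite alt ?flipK //; lia.
Qed.

Section EqMod1.
Variable K : realType.
Implicit Types a b c : K.

Lemma eq_mod1_refl a : eq_mod1 a a.
Proof. by rewrite /eq_mod1 subrr rpred0. Qed.

Lemma eq_mod1_sym a b : eq_mod1 a b -> eq_mod1 b a.
Proof. by rewrite /eq_mod1 -rpredN opprB. Qed.

Lemma eq_mod1_trans b a c : eq_mod1 a b -> eq_mod1 b c -> eq_mod1 a c.
Proof. by move=> ab bc; have := rpredD ab bc; rewrite addrA subrK. Qed.

Lemma eq_mod1D2r c a b : eq_mod1 (a + c) (b + c) <-> eq_mod1 a b.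
Proof. by rewrite /eq_mod1 opprD addrACA subrr addr0. Qed.

Lemma eq_mod1E a b : eq_mod1 a b <-> exists q : int, a = b + q%:~R.
Proof.
split=> [/intrP[q e]|[q ->]]; last by apply/intrP; exists q; rewrite addrC addKr.
by exists q; rewrite -e addrC subrK.
Qed.

(** The common form of the three last conditions, the break lying at 0, at 1 or at
|v| + 1. The bound [i.+2] says that besides the alternating part and the breaking
side the first letter of v, if there is one, is flipped. *)
Definition crossed (j : nat) (x y : lseq letter) : Prop :=
  [/\ breaks_at (proj x) j, proj x j = L,
      forall i, proj y i = if (j <= i.+2)%N then flip (proj x i) else proj x i &
      eq_mod1 (theta K y) (theta K x + kappa K j)].

Definition linked (x y : lseq letter) : Prop :=
  cond1 K x y \/ exists j, crossed j x y \/ crossed j y x.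

Lemma crossed_breaks j x y : crossed j x y -> breaks_at (proj y) j /\ proj y j = R.
Proof.
move=> [[alt brk] xj yE _].
have yE' i : (j <= i.+2)%N -> proj y i = flip (proj x i) by rewrite yE => ->.
have yj : proj y j = R by rewrite yE' ?xj //; lia.
split=> //; split=> [i ji|j0]; first by rewrite !yE' ?alt //; lia.
by rewrite yj yE' ?brk ?xj //; lia.
Qed.

Lemma crossed_chain i j x y z : crossed i x y -> crossed j y z -> False.
Proof.
move=> /crossed_breaks[by1 yi] [by2 yj _ _].
by have ij := breaks_at_inj by1 by2; rewrite ij yj in yi.
Qed.

Lemma crossed_fun i j x y z : crossed i x y -> crossed j x z -> cond1 K y z.
Proof.
move=> [bi _ yE ty] [bj _ zE tz]; have ij := breaks_at_inj bi bj.
rewrite ij in yE ty; split=> [k|]; first by rewrite yE zE.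
exact: eq_mod1_trans ty (eq_mod1_sym tz).
Qed.

Lemma crossed_inj i j x y z : crossed i x z -> crossed j y z -> cond1 K x y.
Proof.
move=> ox oy; have [bi _] := crossed_breaks ox; have [bj _] := crossed_breaks oy.
have ij := breaks_at_inj bi bj; subst j.
have [_ _ zx tx] := ox; have [_ _ zy ty] := oy; split=> [k|].
  have := zx k; rewrite zy; case: ifP => // _.
  by move=> /(congr1 flip); rewrite !flipK.
by apply/(eq_mod1D2r (kappa K i)); apply: eq_mod1_trans ty; apply: eq_mod1_sym.
Qed.

Lemma cond1_sym x y : cond1 K x y -> cond1 K y x.
Proof. by move=> [p t]; split; [move=> k; rewrite p|apply: eq_mod1_sym]. Qed.

Lemma cond1_trans x y z : cond1 K x y -> cond1 K y z -> cond1 K x z.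
Proof.
move=> [p t] [p' t']; split; first by move=> k; rewrite p.
exact: eq_mod1_trans t t'.
Qed.

Lemma crossed_cond1l j x y z : cond1 K x y -> crossed j y z -> crossed j x z.
Proof.
move=> [/funext p t] [b e zE tz]; rewrite /crossed p; split => //.
by apply: eq_mod1_trans tz _; apply/eq_mod1D2r/eq_mod1_sym.
Qed.

Lemma crossed_cond1r j x y z : crossed j x y -> cond1 K y z -> crossed j x z.
Proof.
move=> [b e yE ty] [p t]; split => // [i|]; first by rewrite -p yE.
exact: eq_mod1_trans (eq_mod1_sym t) ty.
Qed.

Lemma linked_sym x y : linked x y -> linked y x.
Proof.
case=> [/cond1_sym|[j o]]; first by left.
by right; exists j; case: o; [right|left].
Qed.

(** The position where the alternating part of a sequence ends is unique, and the side
there decides whether the sequence comes first or second in its pairs. Hence two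
crossings in a row lead back to the same sides. *)
Lemma linked_trans y x z : linked x y -> linked y z -> linked x z.
Proof.
move=> [c|[i oxy]] [c'|[j oyz]].
- by left; apply: cond1_trans c'.
- right; exists j; case: oyz => o; [left; exact: crossed_cond1l o|right].
  exact: crossed_cond1r o (cond1_sym c).
- right; exists i; case: oxy => o; [left; exact: crossed_cond1r o c'|right].
  exact: crossed_cond1l (cond1_sym c') o.
- case: oxy oyz => [o1|o1] [o2|o2].
  + by case: (crossed_chain o1 o2).
  + by left; apply: crossed_inj o1 o2.
  + by left; apply: crossed_fun o1 o2.
  + by case: (crossed_chain o2 o1).
Qed.
End EqMod1.

(** * The four conditions in terms of breaks *)

Lemma altE a i : iter i flip a = if odd i then flip a else a.
Proof. by elim: i => //= i ->; case: (odd i); rewrite ?flipK. Qed.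

Lemma RLpowE i : lseq_pow [:: R; L] i = iter i flip L.
Proof. by rewrite /lseq_pow modn2 altE; case: (odd i). Qed.

Lemma LRpowE i : lseq_pow [:: L; R] i = iter i flip R.
Proof. by rewrite /lseq_pow modn2 altE; case: (odd i). Qed.

Lemma lseq_cat_ge (A : Type) (w : lseq A) v i : (size v <= i)%N ->
  lseq_cat w v i = w (i - size v)%N.
Proof. by rewrite /lseq_cat ltnNge => ->. Qed.

Lemma lseq_cat_lt (A : Type) (d : A) (w : lseq A) v i : (i < size v)%N ->
  lseq_cat w v i = nth d v (size v - i.+1).
Proof. by move=> iv; rewrite /lseq_cat iv nth_rev // (set_nth_default d) //; lia. Qed.

Lemma nth_change_first s k : (k < size s)%N ->
  nth L (change_first s) k = if k == 0%N then flip (nth L s k) else nth L s k.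
Proof. by case: s k => [|a s] [|k]. Qed.

Lemma cat_breaks v : let s := lseq_cat (lseq_pow [:: R; L]) (L :: v) in
  breaks_at s (size v).+1 /\ s (size v).+1 = L.
Proof.
move=> s; have sE i : (size v < i)%N -> s i = iter (i - (size v).+1) flip L.
  by move=> vi; rewrite /s lseq_cat_ge // RLpowE.
have s0 : s (size v).+1 = L by rewrite sE // subnn.
split => //; split=> [i vi|_]; first by rewrite !sE ?subSn //; exact: leqW.
by rewrite s0 /s (lseq_cat_lt L) //= subnn.
Qed.

Lemma cat_flip v i :
  lseq_cat (lseq_pow [:: L; R]) (R :: change_first v) i
  = let s := lseq_cat (lseq_pow [:: R; L]) (L :: v) in
    if ((size v).+1 <= i.+2)%N then flip (s i) else s i.
Proof.
rewrite /=; have [vi|iv] := leqP (size v).+1 i.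
  rewrite !lseq_cat_ge /= ?size_change_first // LRpowE RLpowE leqW // ?leqW //.
  by elim: (i - _)%N => //= m ->.
rewrite !(lseq_cat_lt L) /= ?size_change_first // subSS.
have [->|ne] := eqVneq i (size v); first by rewrite subnn leqW.
have -> : (size v - i = (size v - i.+1).+1)%N by lia.
rewrite /= nth_change_first; last by lia.
by congr (if _ then _ else _); lia.
Qed.

Lemma cat_of_breaks s j : breaks_at s j.+1 -> s j.+1 = L ->
  s =1 lseq_cat (lseq_pow [:: R; L]) (L :: lseq_trunc s j).
Proof.
move=> b sj i; have [ji|ij] := leqP j.+1 i.
  rewrite lseq_cat_ge /= size_trunc // RLpowE.
  have := @breaks_iter s j.+1 i (i - j.+1) b.
  rewrite subnKC // subKn // => /(_ (leqnn _)) e.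
  by rewrite -sj e -iterD altE oddD addbb.
rewrite (lseq_cat_lt L) /= size_trunc // subSS.
move: ij; rewrite ltnS leq_eqVlt => /orP[/eqP ->|ij].
  by rewrite subnn /= -sj; case: b => _ /(_ isT).
have -> : (j - i = (j - i.+1).+1)%N by lia.
rewrite /= nth_rev size_mkseq ?nth_mkseq; try lia.
by congr s; lia.
Qed.

Section Conditions.
Variable K : realType.

(** The conditions express the first angle through the second one, [crossed] does the
opposite. *)
Lemma eq_mod1_swap (a b c d : K) : eq_mod1 (c + d) 0 ->
  eq_mod1 a (b + c) -> eq_mod1 b (a + d).
Proof.
rewrite /eq_mod1 subr0 => cd ab; rewrite -rpredN; have := rpredD ab cd.
by congr (_ \is a Num.int); ring.
Qed.

Lemma cond2_crossed x y : cond2 K x y <-> crossed K 0 x y.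
Proof.
have int1 : eq_mod1 (2 / 3 + 1 / 3 : K) 0.
  by apply/eq_mod1E; exists 1; rewrite add0r; field.
split=> [[px py t]|[b x0 yE t]].
  split; [split => // i _|by rewrite px|move=> i|exact: eq_mod1_swap t].
    by rewrite !px !RLpowE.
  by rewrite py px RLpowE LRpowE; elim: i => //= i ->.
have px : proj x =1 lseq_pow [:: R; L].
  move=> i; have := @breaks_iter _ _ i i b (leqnn i); rewrite subnn x0 RLpowE => ->.
  by rewrite -iterD altE oddD addbb.
split=> // [i|].
  by rewrite yE px RLpowE LRpowE; elim: i {px yE} => //= i ->.
by apply: eq_mod1_swap t; rewrite addrC.
Qed.

Lemma crossed_of_tail x y v :
  [/\ proj x =1 lseq_cat (lseq_pow [:: R; L]) (L :: v),
      proj y =1 lseq_cat (lseq_pow [:: L; R]) (R :: change_first v) &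
      eq_mod1 (theta K x) (theta K y + 1 / (2 ^+ size v * 3))]
  -> crossed K (size v).+1 x y.
Proof.
move=> [/funext px py t]; have [b e] := cat_breaks v.
split; [by rewrite px|by rewrite px|by move=> i; rewrite py px cat_flip|].
by apply: eq_mod1_swap t; rewrite /kappa subrr; apply: eq_mod1_refl.
Qed.

Lemma tail_of_crossed x y j : crossed K j.+1 x y ->
  let v := lseq_trunc (proj x) j in
  [/\ proj x =1 lseq_cat (lseq_pow [:: R; L]) (L :: v),
      proj y =1 lseq_cat (lseq_pow [:: L; R]) (R :: change_first v) &
      eq_mod1 (theta K x) (theta K y + 1 / (2 ^+ size v * 3))].
Proof.
move=> [b e yE t] v; have px := cat_of_breaks b e.
split => // [i|].
  by rewrite cat_flip yE /= -px /v size_trunc.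
by apply: eq_mod1_swap t; rewrite /kappa /v size_trunc addrC subrr; apply: eq_mod1_refl.
Qed.

Lemma conds_crossed x y :
  cond2 K x y \/ cond3 K x y \/ cond4 K x y <-> exists j, crossed K j x y.
Proof.
split=> [[/cond2_crossed|[c|[v [_ px py t]]]]|[[|[|j]] o]]; first by exists 0%N.
- exists 1%N; apply: (@crossed_of_tail _ _ [::]); case: c => px py.
  by move=> t; split => //; rewrite /= expr0 (mul1r 3).
- by exists (size v).+1; apply: crossed_of_tail.
- by left; apply/cond2_crossed.
- right; left; have [px py t] := tail_of_crossed o; split => //.
  by rewrite /= expr0 (mul1r 3) in t.
- right; right; exists (lseq_trunc (proj x) j.+1).
  by have [px py t] := tail_of_crossed o; split => //; rewrite truncS.
Qed.

Lemma linkedE x y : linked K x y <->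
  exists w1 w2 : lseq letter,
    ((w1 = x /\ w2 = y) \/ (w1 = y /\ w2 = x)) /\
    (cond1 K w1 w2 \/ cond2 K w1 w2 \/ cond3 K w1 w2 \/ cond4 K w1 w2).
Proof.
split=> [[c|[j [o|o]]]|[w1 [w2 [e c]]]].
- by exists x, y; split; left.
- by exists x, y; split; [left|right; apply/conds_crossed; exists j].
- by exists y, x; split; [right|right; apply/conds_crossed; exists j].
have {c} c : linked K w1 w2.
  case: c => [c|/conds_crossed[j o]]; first by left.
  by right; exists j; left.
by case: e => -[<- <-] //; apply: linked_sym.
Qed.
End Conditions.

(** * Related sequences are asymptotically equivalent *)

Definition tau_pow (k : nat) : tree_aut := iter k (aut_mul gen_tau) aut_one.

Lemma in_tau_pow k : in_group (tau_pow k).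
Proof.
by elim: k => [|k IHk]; [apply: in_one|apply: in_mul => //; apply: in_tau].
Qed.

Lemma tau_pow_coords k u :
  sides (tau_pow k u) = sides u /\ moved u (tau_pow k u) k%:Z.
Proof.
elim: k => [|k [s [q m]]]; first by split => //; exists 0; rewrite mul0r !addr0.
have [s' [q' m']] := tau_coords (tau_pow k u).
change (tau_pow k.+1 u) with (gen_tau (tau_pow k u)).
split; first by rewrite s'.
by exists (q + q'); rewrite m' m size_aut; lia.
Qed.

(** Natural exponents reach every shift between [- C] and [C] by going back [C] steps
from a shift between 0 and [2 C]. *)
Definition tau_shift (C k : nat) : tree_aut :=
  aut_mul (aut_inv (tau_pow C)) (tau_pow k).

Lemma tau_shift_coords C k u :
  sides (tau_shift C k u) = sides u /\ moved u (tau_shift C k u) (k%:Z - C%:Z).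
Proof.
have [s [q m]] := tau_pow_coords k u.
have [] := tau_pow_coords C (tau_shift C k u).
rewrite /tau_shift /= autVK s => s' [q' m']; split => //.
move: m'; rewrite m size_autV size_aut => m'.
by exists (q - q'); lia.
Qed.

Definition movers : set tree_aut :=
  [set aut_one] `|` [set gen_P] `|` [set gen_S] `|` [set aut_inv gen_S].

Lemma in_movers h : movers h -> in_group h.
Proof.
case=> [[[->|->]|->]|->]; [apply: in_one|apply: in_P|apply: in_S|].
exact/in_inv/in_S.
Qed.

Lemma finite_movers : finite_set movers.
Proof. by rewrite /movers !finite_setU; do !split; apply: finite_set1. Qed.

Definition reached (C : nat) (n : nat) (x y : lseq letter) : Prop :=
  exists2 h, movers h &
    sides (h (lseq_trunc x n)) = sides (lseq_trunc y n) /\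
    exists q : int, `|value (lseq_trunc y n) - value (h (lseq_trunc x n))
                      - q * 2 ^+ n| <= C%:Z.

(** A remaining difference of at most [C] modulo 2^n is removed by one of finitely many
powers of tau, so that finitely many group elements suffice. *)
Lemma asymp_of_reached C x y : (forall n, reached C n x y) -> asymp_equiv x y.
Proof.
move=> car.
have /choice[g gP] n : exists g : tree_aut,
    g (lseq_trunc x n) = lseq_trunc y n /\
    exists p : tree_aut * nat, (movers `*` `I_((C + C).+1))%classic p /\
      g = aut_mul (tau_shift C p.2) p.1.
  have [h hm [s [q b]]] := car n.
  set d : int := _ - _ - _ in b.
  have [k kE] : exists k : nat, k%:Z = d + C%:Z by exists `|(d + C%:Z)%R|%N; lia.
  exists (aut_mul (tau_shift C k) h); split; last first.
    by exists (h, k); split => //; split => //=; lia.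
  have [s' [q' m]] := tau_shift_coords C k (h (lseq_trunc x n)).
  have sz : size (aut_mul (tau_shift C k) h (lseq_trunc x n)) = n.
    by rewrite size_aut size_trunc.
  apply: word_inj; first by rewrite -s -s'.
  have /= := value_bounds (tau_shift C k (h (lseq_trunc x n))).
  have := value_bounds (lseq_trunc y n).
  move: m; rewrite !size_autV !size_aut !size_trunc.
  set A := value _; set B := value (lseq_trunc y n); set H := value (h _) in d b kE *.
  rewrite kE /d -/B => m b1 b2.
  have e : A - B = (q' - q) * 2 ^+ n by rewrite m; ring.
  (* Both integers lie between 0 and 2^n, so a multiple of 2^n apart means equal. *)
  suff : q' - q = 0 by move=> z; rewrite z mul0r in e; apply/eqP; rewrite -subr_eq0 e.
  by nia.
exists g; split=> [n||n]; last by case: (gP n).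
- have [_ [[h k] [[/= hm _] ->]]] := gP n.
  apply: in_mul; last exact: in_movers.
  by apply: in_mul; [apply/in_inv|]; apply: in_tau_pow.
- apply: (@sub_finite_set _ _ ((fun p => aut_mul (tau_shift C p.2) p.1) @`
      (movers `*` `I_((C + C).+1)))%classic).
    by move=> _ [n _ <-]; have [_ [p [pI ->]]] := gP n; exists p.
  by apply/finite_image/finite_setX; [apply: finite_movers|apply: finite_II].
Qed.

Lemma asymp_sym x y : asymp_equiv x y -> asymp_equiv y x.
Proof.
move=> [g [gG gfin gxy]]; exists (fun n => aut_inv (g n)); split=> [n||n].
- exact: in_inv.
- apply: (@sub_finite_set _ _ (aut_inv @` range g)%classic).
    by move=> _ [n _ <-]; exists (g n) => //; exists n.
  exact: finite_image.
- by rewrite /= -gxy autK.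
Qed.

Lemma eq_from_last (s t : seq side) n : size s = n -> size t = n ->
  (forall i, (i < n)%N -> nth L s (n - i.+1) = nth L t (n - i.+1)) -> s = t.
Proof.
move=> sn tn e; apply: (@eq_from_nth _ L); first by rewrite sn.
move=> i; rewrite sn => ni; have := e (n - i.+1)%N.
by have -> : (n - (n - i.+1).+1 = i)%N by [lia]; apply; lia.
Qed.

Lemma nth_cross_last a s i : (i < size s)%N ->
  nth L (cross a s) (size s - i.+1) =
  if (size s - run a s <= i.+2)%N then flip (nth L s (size s - i.+1))
  else nth L s (size s - i.+1).
Proof.
move=> si; rewrite nth_cross; last by lia.
by have := run_le a s => rs; congr (if _ then _ else _); lia.
Qed.

Lemma trunc_side x n i : (i < n)%N ->
  nth L (sides (lseq_trunc x n)) (n - i.+1) = proj x i.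
Proof.
move=> ni; have := agrees_side (agrees_trunc x (leqnn n)) ni.
by rewrite size_trunc.
Qed.

Lemma value_dist_trivial u v n : size u = n -> size v = n ->
  `|value u - value v - 0 * 2 ^+ n| <= 2 ^+ n.
Proof.
by move=> un vn; have := value_bounds u; have := value_bounds v; rewrite un vn; lia.
Qed.

Section Crossed.
Variables (K : realType) (j : nat) (x y : lseq letter).
Hypothesis o : crossed K j x y.

(** If [n > j], the prefix starts with the leftmost side of the truncation, and this
side determines whether S or S^-1 is taken. If [n = j], the leftmost side is the
breaking one, an [L], and S has an empty alternating prefix there. *)
Lemma crossed_run n : (0 < n)%N -> (j <= n)%N ->
  exists a, run a (sides (lseq_trunc x n)) = (n - j)%N /\
            iter (n - j) flip a = R.
Proof.
case: o => b xj _ _ n0; rewrite leq_eqVlt => /orP[/eqP jn|jn].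
  exists R; rewrite jn subnn; split => //; apply: run_eq => // _ /=.
  have := @trunc_side x n n.-1; rewrite prednK // subnn => -> //.
  by case: b => _; rewrite jn => /(_ n0) ->; rewrite -jn xj.
have alt i : (i < n - j)%N -> proj x (n - i.+1)%N = iter i flip (proj x n.-1).
  move=> ij; rewrite -(@breaks_iter _ j _ i b); last by lia.
  by congr proj; lia.
have xjE : iter (n - j.+1) flip (proj x n.-1) = L.
  rewrite -alt; last by lia.
  by have -> : (n - (n - j.+1).+1 = j)%N by lia.
exists (proj x n.-1); rewrite -subnSK // iterS xjE; split => //.
have nthE i : (i < n)%N -> nth L (sides (lseq_trunc x n)) i = proj x (n - i.+1)%N.
  move=> ni; have := @trunc_side x n (n - i.+1)%N.
  by have -> : (n - (n - i.+1).+1 = i)%N by [lia]; apply; lia.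
rewrite subnSK //; apply: run_eq => [|i ij|].
- by rewrite size_sides size_trunc leq_subr.
- by rewrite nthE ?alt //; lia.
- rewrite size_sides size_trunc -(subnSK jn) => h.
  rewrite nthE // !iterS xjE /= ; have [_ brk] := b.
  have -> : (n - (n - j.+1).+2 = j.-1)%N by lia.
  by rewrite brk ?xj //; lia.
Qed.

Lemma crossed_reached_by_S n : (0 < n)%N -> (j <= n)%N -> reached 3 n x y.
Proof.
move=> n0 jn; have [a [ra ea]] := crossed_run n0 jn.
have [b xj yE t] := o.
exists (S_from a); first by case: (a); [right|left; right].
split.
  apply: (@eq_from_last _ _ n); rewrite ?size_sides ?size_aut ?size_trunc //.
  move=> i ni; rewrite trunc_side // yE; have [-> _] := S_coords a (lseq_trunc x n).
  have := @nth_cross_last a (sides (lseq_trunc x n)) i.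
  rewrite !size_sides !size_trunc ra trunc_side // => -> //.
  by rewrite subKn.
have [q1] := angle_S K a (lseq_trunc x n).
rewrite ra size_trunc ea subKn // mul1r => eS.
have /eq_mod1E[q2 eT] := t.
have dx := agrees_theta K (agrees_trunc x (leqnn n)).
have dy := agrees_theta K (agrees_trunc y (leqnn n)).
exists (q2 - q1); rewrite -(ler_int K) !(intrB, intrM, intr_norm) rmorphXn /=.
set vy : K := (value (lseq_trunc y n))%:~R.
set vx : K := (value (S_from a _))%:~R.
have p0 := exp2_gt0 K n.
have -> : vy - vx - (q2%:~R - q1%:~R) * 2 ^+ n
  = (angle K (lseq_trunc y n) - angle K (S_from a (lseq_trunc x n))
     - q2%:~R + q1%:~R) * 2 ^+ n.
  by rewrite /angle size_aut !size_trunc -/vy -/vx; field; rewrite gt_eqF.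
rewrite normrM (gtr0_norm p0) -ler_pdivlMr //.
move: dx dy; rewrite eS eT !ler_norml => /andP[x1 x2] /andP[y1 y2].
have i0 : 0 < 1 / 2 ^+ n :> K by rewrite divr_gt0.
have s3 : `|(sgn a)%:~R : K| <= 1 by rewrite sgn_norm.
have -> : (sgn a)%:~R / (3 * 2 ^+ n) = (sgn a)%:~R / 3 * (1 / 2 ^+ n) :> K.
  by field; rewrite gt_eqF.
have -> : 3%:Z%:~R / 2 ^+ n = 3 * (1 / 2 ^+ n) :> K by field; rewrite gt_eqF.
move: (1 / 2 ^+ n) i0 x1 x2 y1 y2 => z i0 x1 x2 y1 y2.
move: s3; rewrite ler_norml => /andP[s1 s2]; apply/andP; split; nra.
Qed.

(** The truncations shorter than [j] do not see the alternating part, so identity and P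
give their sides; as there are finitely many of them, their integers need no
estimate beyond the trivial one. *)
Lemma crossed_reached n : reached (2 ^ j + 3) n x y.
Proof.
have weaken C C' : (C <= C')%N -> reached C n x y -> reached C' n x y.
  move=> CC' [h hm [s [q b]]]; exists h => //; split => //; exists q.
  by apply: le_trans b _; rewrite lez_nat.
have [_ _ yE _] := o.
have [/andP[n0 jn]|short] := boolP ((0 < n) && (j <= n))%N.
  by apply: (weaken 3%N); [rewrite leq_addl|exact: crossed_reached_by_S].
have nj : (n <= j)%N by lia.
apply: (weaken (2 ^ n)%N); first by rewrite (leq_trans (leq_pexp2l _ nj)) ?leq_addr.
have bound h : exists q : int, `|value (lseq_trunc y n) - value (aut h (lseq_trunc x n))
                      - q * 2 ^+ n| <= (2 ^ n)%N%:Z.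
  exists 0; rewrite (_ : (2 ^ n)%N%:Z = 2 ^+ n).
    by rewrite value_dist_trivial ?size_aut ?size_trunc.
  by rewrite -natz natrX.
have [jn1|jn1] := eqVneq j n.+1.
  exists gen_P; first by left; left; right.
  split; last exact: bound.
  rewrite sides_P; apply: (@eq_from_last _ _ n);
    rewrite ?size_change_first ?size_sides ?size_trunc // => i ni.
  rewrite nth_change_first ?size_sides ?size_trunc; last by lia.
  by rewrite !trunc_side // yE jn1; congr (if _ then _ else _); lia.
exists aut_one; first by left; left; left.
split; last exact: bound.
apply: (@eq_from_last _ _ n); rewrite ?size_sides ?size_trunc // => i ni.
by rewrite !trunc_side // yE ifF //; lia.
Qed.
End Crossed.

Lemma cond1_reached (K : realType) x y n : cond1 K x y -> reached 2 n x y.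
Proof.
move=> [p /eq_mod1E[q t]]; exists aut_one; first by left; left; left.
split.
  apply: (@eq_from_last _ _ n); rewrite ?size_sides ?size_trunc // => i ni.
  by rewrite !trunc_side // p.
have dx := agrees_theta K (agrees_trunc x (leqnn n)).
have dy := agrees_theta K (agrees_trunc y (leqnn n)).
exists (- q); rewrite -(ler_int K) !(intrB, intrM, intr_norm, intrN) rmorphXn /=.
have p0 := exp2_gt0 K n.
set vy : K := (value (lseq_trunc y n))%:~R.
set vx : K := (value _)%:~R.
have -> : vy - vx - - q%:~R * 2 ^+ n
  = (angle K (lseq_trunc y n) - angle K (lseq_trunc x n) + q%:~R) * 2 ^+ n.
  by rewrite /angle !size_trunc -/vy -/vx; field; rewrite gt_eqF.
rewrite normrM (gtr0_norm p0) -ler_pdivlMr //.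
have -> : 2%:Z%:~R / 2 ^+ n = 2 * (1 / 2 ^+ n) :> K by field; rewrite gt_eqF.
move: dx dy; rewrite t !ler_norml => /andP[x1 x2] /andP[y1 y2].
by apply/andP; split; lra.
Qed.

Lemma asymp_of_linked (K : realType) x y : linked K x y -> asymp_equiv x y.
Proof.
case=> [c|[j [o|o]]].
- by apply: (@asymp_of_reached 2) => n; apply: cond1_reached c.
- by apply: asymp_of_reached => n; apply: crossed_reached o _.
- by apply/asymp_sym/asymp_of_reached => n; apply: crossed_reached o _.
Qed.

(** * Asymptotically equivalent sequences are related *)

Lemma ultra_pigeonhole (I T : Type) (F : set_system I) (A : set T) (c : I -> T) :
  UltraFilter F -> finite_set A -> F [set i | A (c i)] ->
  exists2 a, A a & F [set i | c i = a].
Proof.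
move=> FU /(@finite_seqP {classic T})[s ->]; elim: s => [|a s IHs] /= FA.
  by have [i] := filter_ex FA; rewrite /= in_nil.
have [Fa|Fa] := in_ultra_setVsetC [set i | c i = a] FU.
  by exists a => //=; rewrite mem_head.
have [|b sb Fb] := IHs.
  apply: filterS (filterI FA Fa) => i [] /=.
  by rewrite in_cons => /orP[/eqP|].
by exists b => //=; rewrite in_cons sb orbT.
Qed.

Section Limits.
Variables (K : realType) (F : set_system nat).
Hypothesis FU : UltraFilter F.
Hypothesis Foo : forall N, F [set n | (N <= n)%N].

(** The words [u n] need not be truncations of one sequence: a tower is what is left of
the truncations of [x] after applying a group element to each of them. *)
Definition tower (u : nat -> word) : Prop := forall n, size (u n) = n.

Definition ulim (u : nat -> word) (x : lseq letter) : Prop :=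
  forall N, F [set n | agrees N (u n) x].

Lemma tower_aut (g : tree_aut) u : tower u -> tower (fun n => g (u n)).
Proof. by move=> tu n; rewrite size_aut. Qed.

(** Compactness: each letter, counted from the right end, takes one of four values and
is therefore constant along the ultrafilter. *)
Lemma ulim_exists u : tower u -> exists x, ulim u x.
Proof.
move=> tu.
have /choice[x xP] i : exists a, F [set n | nth L0 (u n) (n - i.+1) = a].
  have [||a _ Fa] := @ultra_pigeonhole _ _ F [set: letter]
    (fun n => nth L0 (u n) (n - i.+1)) FU; first exact: finite_finset.
  - exact: filterS filterT.
  - by exists a.
exists x; elim=> [|N IHN].
  by apply: filterS filterT => n _; split; rewrite // subn0 drop_size.
apply: filterS (filterI IHN (filterI (xP N) (Foo N.+1))) => n /= [[_ e] [xN Nn]].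
rewrite /agrees tu; split=> //; rewrite truncS -e -xN tu.
by rewrite (drop_nth L0) ?tu ?subnSK //; lia.
Qed.

Lemma ulim_unique u x y : ulim u x -> ulim u y -> x = y.
Proof.
move=> ux uy; apply/funext => i.
have [n [[_ ex] [_ ey]]] := filter_ex (filterI (ux i.+1) (uy i.+1)).
by move: ex; rewrite ey !truncS => -[].
Qed.

Lemma theta_limit (C c : K) u v x y : ulim u x -> ulim v y ->
  (forall N, F [set n | exists q : int,
     `|angle K (v n) - angle K (u n) - c - q%:~R| <= C / 2 ^+ N]) ->
  eq_mod1 (theta K y) (theta K x + c).
Proof.
move=> ux vy close; apply: (@near_int _ (C + 2)) => N.
have [n [[au av] [q b]]] := filter_ex (filterI (filterI (ux N) (vy N)) (close N)).
exists q; have dx := agrees_theta K au; have dy := agrees_theta K av.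
have -> : (C + 2) / 2 ^+ N = C / 2 ^+ N + 2 * (1 / 2 ^+ N) :> K.
  by field; rewrite gt_eqF ?exp2_gt0.
move: dx dy b; rewrite !ler_norml => /andP[x1 x2] /andP[y1 y2] /andP[b1 b2].
by apply/andP; split; lra.
Qed.

Lemma cond1_limit (C : K) u v x y : tower u -> tower v -> ulim u x -> ulim v y ->
  (forall i, F [set n | (i < n)%N ->
     nth L (sides (v n)) (n - i.+1) = nth L (sides (u n)) (n - i.+1)]) ->
  (forall N, F [set n | exists q : int,
     `|angle K (v n) - angle K (u n) - q%:~R| <= C / 2 ^+ N]) ->
  cond1 K x y.
Proof.
move=> tu tv ux vy sd close; split=> [i|].
  have [n [[au av] e]] := filter_ex (filterI (filterI (ux i.+1) (vy i.+1)) (sd i)).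
  have := agrees_side au (ltnSn i); have := agrees_side av (ltnSn i).
  rewrite tu tv e => [-> -> //|]; by case: au; rewrite tu.
apply: eq_mod1_sym; rewrite -[X in eq_mod1 _ X]addr0.
by apply: (theta_limit (C := C) ux vy) => N; under eq_fun do rewrite subr0.
Qed.

(** Stated on limits of towers rather than on truncations so that it is stable under
products. *)
Definition tame (g : tree_aut) : Prop := forall u x y, tower u ->
  ulim u x -> ulim (fun n => g (u n)) y -> linked K x y.

Lemma exp2_le (N n : nat) : (N <= n)%N -> 1 / 2 ^+ n <= 1 / 2 ^+ N :> K.
Proof.
move=> Nn; rewrite !mul1r lef_pV2 ?posrE ?exp2_gt0 //.
by rewrite ler_weXn2l // ler1n.
Qed.

Lemma tame_P : tame gen_P.
Proof.
move=> u x y tu ux vy; left.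
apply: (cond1_limit (C := 0) tu (tower_aut gen_P tu) ux vy) => [i|N].
  apply: filterS (Foo i.+2) => n /= n2 ni.
  rewrite sides_P nth_change_first ?size_sides ?tu; last by lia.
  by rewrite ifF //; lia.
apply: filterS filterT => n _; exists 0.
by rewrite /angle value_P size_aut !subrr normr0 mul0r.
Qed.

Lemma tame_tau : tame gen_tau.
Proof.
move=> u x y tu ux vy; left.
apply: (cond1_limit (C := 1) tu (tower_aut gen_tau tu) ux vy) => [i|N].
  by apply: filterS filterT => n _ /= _; have [-> _] := tau_coords (u n).
apply: filterS (Foo N) => n /= Nn; have [_ [q m]] := tau_coords (u n).
exists q; rewrite /angle m size_aut tu !intrD intrM rmorphXn /=.
have -> : ((value (u n))%:~R + 1 + q%:~R * 2 ^+ n) / 2 ^+ n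
   - (value (u n))%:~R / 2 ^+ n - q%:~R = 1 / 2 ^+ n :> K.
  by field; rewrite gt_eqF ?exp2_gt0.
by rewrite ger0_norm ?exp2_le // divr_ge0 // ltW ?exp2_gt0.
Qed.

Lemma kappa_le j N : (N < j)%N -> `|kappa K j| <= 1 / 2 ^+ N.
Proof.
case: j => // j; rewrite ltnS => Nj; rewrite /kappa normrN ger0_norm; last first.
  by rewrite divr_ge0 // mulr_ge0 // exprn_ge0.
apply: le_trans (exp2_le Nj); rewrite !mul1r lef_pV2 ?posrE ?mulr_gt0 ?exp2_gt0 //.
by have := exp2_gt0 K j; lra.
Qed.

Lemma third_le N n : (N <= n)%N -> `|1 / (3 * 2 ^+ n) : K| <= 1 / 2 ^+ N.
Proof.
move=> Nn; rewrite ger0_norm; last by rewrite divr_ge0 // mulr_ge0 // exprn_ge0.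
apply: le_trans (exp2_le Nn); rewrite !mul1r lef_pV2 ?posrE ?mulr_gt0 ?exp2_gt0 //.
by have := exp2_gt0 K n; lra.
Qed.

Lemma gen_S_side u i : (i < size u)%N ->
  nth L (sides (gen_S u)) (size u - i.+1) =
  if (size u - run R (sides u) <= i.+2)%N
  then flip (nth L (sides u) (size u - i.+1))
  else nth L (sides u) (size u - i.+1).
Proof.
move=> ni; have [-> _] := gen_S_coords u; rewrite -(size_sides u).
by apply: nth_cross_last; rewrite size_sides.
Qed.

(** Far means far from the right end: no fixed position is flipped, and the change of
angle modulo 1 tends to 0. *)
Lemma far_crossing u x y : tower u -> ulim u x -> ulim (fun n => gen_S (u n)) y ->
  (forall N, F [set n | (N < n - run R (sides (u n)))%N]) -> cond1 K x y.
Proof.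
move=> tu ux vy far.
apply: (cond1_limit (C := 2) tu (tower_aut gen_S tu) ux vy) => [i|N].
  apply: filterS (far i.+2) => n /= Jn ni; have := @gen_S_side (u n) i.
  by rewrite tu [(_ <= i.+2)%N]leqNgt Jn => ->.
apply: filterS (filterI (far N) (Foo N)) => n [/= Jn Nn].
have [q eS] := angle_S K R (u n); exists q.
move: eS; rewrite tu => -> /=.
have := kappa_le Jn; have := third_le Nn.
set e := sgn _; have := sgn_norm K (iter (run R (sides (u n))) flip R); rewrite -/e.
move: (1 / _) (kappa _ _) => t k e1 t1 k1.
rewrite (_ : _ - _ - _ = - t + e%:~R * k); last by ring.
apply: le_trans (ler_normD _ _) _; rewrite normrN normrM e1 mul1r.
rewrite (_ : 2 / 2 ^+ N = 1 / 2 ^+ N + 1 / 2 ^+ N :> K); last by rewrite -mulrDl.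
exact: lerD.
Qed.

(** When the break stays at position [j] and the side [c] that would continue the
alternating prefix is constant, all truncations show the same picture near their
right end, so it persists in the limit. *)
Lemma near_crossing u x y j c : tower u ->
  ulim u x -> ulim (fun n => gen_S (u n)) y ->
  F [set n | (n - run R (sides (u n)) = j)%N] ->
  F [set n | iter (run R (sides (u n))) flip R = c] ->
  [/\ forall i, (j <= i)%N -> proj x i = iter (i - j).+1 flip c,
      (0 < j)%N -> proj x j.-1 = flip c,
      forall i, proj y i = if (j <= i.+2)%N then flip (proj x i) else proj x i &
      eq_mod1 (theta K y) (theta K x + (sgn c)%:~R * kappa K j)].
Proof.
move=> tu ux vy Fj Fc; have tv := tower_aut gen_S tu.
split=> [i ji|j0|i|].
- have [n [[/= au nj] nc]] := filter_ex (filterI (filterI (ux i.+1) Fj) Fc).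
  have := agrees_side au (ltnSn i); rewrite tu => <-.
  have ni : (i < n)%N by case: au; rewrite tu.
  rewrite (@nth_run R); last by lia.
  have rn := run_le R (sides (u n)); rewrite size_sides tu in rn.
  rewrite -nc -iterD -iterS.
  have -> : ((i - j + run R (sides (u n))).+1
             = (n - i.+1) + (i - j).+1 + (i - j).+1)%N by lia.
  by rewrite altE [RHS]altE !oddD addbK.
- have [n [[/= au nj] nc]] := filter_ex (filterI (filterI (ux j) Fj) Fc).
  have jn : (j.-1 < j)%N by lia.
  have := agrees_side au jn; rewrite tu => <-.
  have := @nth_break R (sides (u n)); rewrite size_sides tu iterS nc => <-; last by lia.
  by congr nth; lia.
- have [n [[/= au av] nj]] := filter_ex (filterI (filterI (ux i.+1) (vy i.+1)) Fj).
  have := agrees_side au (ltnSn i); have := agrees_side av (ltnSn i).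
  rewrite (tv n) tu => <- <-; have := @gen_S_side (u n) i; rewrite tu nj; apply.
  by case: au; rewrite tu.
- apply: (theta_limit (C := 1) ux vy) => N.
  apply: filterS (filterI (filterI Fj Fc) (Foo N)) => n /= [[nj nc] Nn].
  have [q eS] := angle_S K R (u n); exists q; move: eS; rewrite tu nj nc => -> /=.
  have := third_le Nn; move: (1 / _) (_ * kappa _ _) => t k t1.
  by rewrite (_ : _ - _ - _ - _ = - t) ?normrN //; ring.
Qed.

Lemma crossed_intro x y j :
  (forall i, (j <= i)%N -> proj x i = iter (i - j).+1 flip R) ->
  ((0 < j)%N -> proj x j.-1 = L) ->
  (forall i, proj y i = if (j <= i.+2)%N then flip (proj x i) else proj x i) ->
  eq_mod1 (theta K y) (theta K x + kappa K j) -> crossed K j x y.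
Proof.
move=> alt brk yE t; have xj : proj x j = L by rewrite alt // subnn.
split => //; split=> [i ji|/brk ->//]; rewrite !alt ?subSn //; exact: leqW.
Qed.

(** Along an ultrafilter the distance of the break from the right end either tends to
infinity or is constant; in the second case the parity of the prefix is constant too
and tells which of the two limits comes first. *)
Lemma tame_S : tame gen_S.
Proof.
move=> u x y tu ux vy.
have [far|] := pselect (forall N, F [set n | (N < n - run R (sides (u n)))%N]).
  by left; apply: far_crossing vy far.
move=> /existsNP[N NF].
have FN : F [set n | `I_N.+1 (n - run R (sides (u n)))%N].
  have [//|] := in_ultra_setVsetC [set n | (N < n - run R (sides (u n)))%N] FU.
  by apply: filterS => n /= /negP; rewrite -leqNgt ltnS.
have [j _ Fj] := ultra_pigeonhole FU (finite_II _) FN.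
right; exists j.
have [Fc|Fc] := in_ultra_setVsetC [set n | iter (run R (sides (u n))) flip R = R] FU.
  have [alt brk yE t] := near_crossing tu ux vy Fj Fc.
  by left; apply: crossed_intro => //; rewrite mul1r in t.
have {}Fc : F [set n | iter (run R (sides (u n))) flip R = L].
  by apply: filterS Fc => n /=; case: (iter _ _ _).
have [alt brk yE t] := near_crossing tu ux vy Fj Fc.
right; apply: crossed_intro => [i ji|j0|i|].
- have flip_iter k : flip (iter k flip L) = iter k flip R by elim: k => //= k ->.
  by rewrite yE alt // flip_iter ifT //; lia.
- by rewrite yE brk //; have -> : (j <= j.-1.+2)%N by lia.
- by rewrite yE; case: (j <= i.+2)%N; rewrite ?flipK.
- apply: eq_mod1_sym; move/(eq_mod1D2r (kappa K j)): t.
  by rewrite mulN1r subrK.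
Qed.

Lemma tame_in_group g : in_group g -> tame g.
Proof.
elim=> {g} [|||u x y tu ux vy|g h _ tg _ th u x y tu ux vy|g _ tg u x y tu ux vy].
- exact: tame_P.
- exact: tame_S.
- exact: tame_tau.
- rewrite (ulim_unique ux vy); left; split => //; exact: eq_mod1_refl.
- have [z uz] := ulim_exists (tower_aut h tu).
  apply: (linked_trans (th _ _ _ tu ux uz)).
  exact: (tg _ _ _ (tower_aut h tu) uz vy).
- apply/linked_sym/(tg _ _ _ (tower_aut (aut_inv g) tu) vy).
  by under eq_fun do rewrite /= autVK.
Qed.
End Limits.

Lemma linked_of_asymp (K : realType) x y : asymp_equiv x y -> linked K x y.
Proof.
move=> [g [gG gfin gxy]].
have [F [FU Foo]] := ultraFilterLemma (eventually_filter).
have FN N : F [set n | (N <= n)%N] by apply: Foo; exists N.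
have [h [m _ <-] Fh] : exists2 h, range g h & F [set n | g n = h].
  apply: ultra_pigeonhole gfin _; apply: filterS filterT => n _; by exists n.
apply: (@tame_in_group K F FU FN _ (gG m) (lseq_trunc x)).
- by move=> n; rewrite size_trunc.
- by move=> N; apply: filterS (FN N) => n; apply: agrees_trunc.
- move=> N; apply: filterS (filterI Fh (FN N)) => n /= [<- Nn].
  by rewrite gxy; apply: agrees_trunc.
Qed.

Theorem proposition3p14 (K : realType) (x y : lseq letter) :
  asymp_equiv x y <->
  exists w1 w2 : lseq letter,
    ((w1 = x /\ w2 = y) \/ (w1 = y /\ w2 = x)) /\
    (cond1 K w1 w2 \/ cond2 K w1 w2 \/ cond3 K w1 w2 \/ cond4 K w1 w2).
Proof.
by rewrite -linkedE; split; [apply: linked_of_asymp|apply: asymp_of_linked].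
Qed.
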